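(* Let $N\ge 1$ be an integer and let $f:[0,1]\to\mathbb{R}$ satisfy the Hölder condition $|f(x')-f(x'')|\le H|x'-x''|^{1/N}$ for all $x',x''\in[0,1]$, with some constant $0<H<\infty$. Consider the algorithm MGAS (as defined in the context), applied to $f$ and run without stopping, i.e., with infinitely many iterations $k=1,2,\dots$. If the parameter $\eta$ of the algorithm equals $0$, then for any point $x\in D=[0,1]$ and any $\delta>0$ there exists an iteration number $k(\delta)\ge 1$ such that for $k>k(\delta)$ there is a point $x'\in\{x^{j(k)}\}$ with $|x-x'|<\delta$, where $\{x^{j(k)}\}$ denotes the trial points generated by the algorithm in its first $k$ iterations.
   Context: Origin of $f$: in the paper, $f(x)=F(p_M(x))$, where $F$ is a Lipschitz function on a hyperinterval $[a,b]\subset\mathbb{R}^N$ and $p_M:[0,1]\to[a,b]$ is a level-$M$ approximation of the Peano space-filling curve; the convergence analysis concerns the one-dimensional method applied to $f$ on $[0,1]$ under the Hölder condition with exponent $1/N$. A trial is an evaluation of $f$ at a point, called a trial point. The algorithm has parameters $\eta\ge 0$ and $\xi\ge 0$ ($\xi$ may depend on the iteration; in the paper's implementation $\xi=\epsilon|f_{\min}(k)|$ with a fixed $\epsilon\ge 0$). The Hölder constant $H$ is not known to the algorithm. Partition and lower bounds. At iteration $k$ the algorithm has a current partition $D^k$ of $D=[0,1]$ into finitely many closed intervals $d_i=[a_i,b_i]$ with disjoint interiors. For each interval let $m_i=(a_i+b_i)/2$ (at which $f$ has already been evaluated), and for $\tilde H>0$ let $$R_i(\tilde H)=f(m_i)-\tilde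 H\,\bigl|(b_i-a_i)/2\bigr|^{1/N}.$$ Domination. Given $\tilde H>0$, an interval $d_i\in D^k$ dominates $d_j\in D^k$ with respect to $\tilde H$ if $R_i(\tilde H)<R_j(\tilde H)$. An interval $d_t\in D^k$ is nondominated with respect to $\tilde H$ if no other interval of $D^k$ dominates it with respect to $\tilde H$. An interval $d_t\in D^k$ is nondominated if there exists $0<\tilde H<\infty$ such that $d_t$ is nondominated with respect to $\tilde H$. Algorithm MGAS. Step 0 (initialization). Set $k=1$ and $D^1=\{[0,1/3],[1/3,2/3],[2/3,1]\}$; perform trials at $x^1=1/6$, $x^2=1/2$, $x^3=5/6$. Let $f_{\min}(k)$ denote the smallest value of $f$ found at the trial points generated so far at the beginning of Step 1 of iteration $k$; thus $f_{\min}(1)=\min\{f(x^1),f(x^2),f(x^3)\}$. Step 1. Let $S^k\subset D^k$ be the set of all nondominated intervals $d_t=[a_t,b_t]\in D^k$ satisfying both of the following conditions: (i) for some $0<\tilde H<\infty$ with respect to which $d_t$ is nondominated, $R_t(\tilde H)\le f_{\min}(k)-\xi$; (ii) $b_t-a_t>\eta$. Step 2. Set $D^{k+1}=D^k$. Process the intervals of $S^k$ one after another, in order of decreasing length. Each $d_t=[a_t,b_t]\in S^k$ is removed from $D^{k+1}$ and replaced by the three equal intervals $[a_t,p_t]$, $[p_t,q_t]$, $[q_t,b_t]$, where $p_t=a_t+(b_t-a_t)/3$ and $q_t=b_t-(b_t-a_t)/3$. Two new trials are performed, at $c_1=(a_t+p_t)/2$ and $c_2=(q_t+b_t)/2$;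 the central interval $[p_t,q_t]$ inherits the already evaluated point $(a_t+b_t)/2=(p_t+q_t)/2$. Update the record value when necessary. Step 3. Set $k=k+1$ and go to Step 1. *)

(* Defs.v *)
From mathcomp Require Import all_boot all_order all_algebra.
From mathcomp Require Import finmap.
From mathcomp Require Import boolp reals exp.
Set Implicit Arguments.
Unset Strict Implicit.
Unset Printing Implicit Defensive.
Import Order.TTheory GRing.Theory Num.Theory.
Local Open Scope ring_scope.

Section Mgas.
Variable R : realType.

(* The pair (a, b) stands for the closed interval [a, b]. *)
Local Notation itvl := (R * R)%type.

Definition len (d : itvl) : R := d.2 - d.1.
Definition mid (d : itvl) : R := (d.1 + d.2) / 2.

Record state := State {
  part : {fset itvl};   (* the current partition *)
  trials : seq R        (* all the trial points, in the order of generation *)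
}.

Section Selection.
Variables (N : nat) (f : R -> R).

Definition lower_bound (Ht : R) (d : itvl) : R :=
  f (mid d) - Ht * `|(d.2 - d.1) / 2| `^ (N%:R^-1).

Definition dominates (Ht : R) (d e : itvl) : bool :=
  lower_bound Ht d < lower_bound Ht e.

Definition nondominated_wrt (D : {fset itvl}) (Ht : R) (d : itvl) : Prop :=
  d \in D /\ forall e, e \in D -> e != d -> ~~ dominates Ht e d.

Definition nondominated (D : {fset itvl}) (d : itvl) : Prop :=
  exists2 Ht : R, 0 < Ht & nondominated_wrt D Ht d.

(* The list of trial points of a reachable state is never empty, so that the
   default value 0 of [head] plays no role. *)
Definition fmin (s : state) : R :=
  \big[Num.min/f (head 0 (trials s))]_(x <- trials s) f x.

Definition selectable (eta xi : R) (s : state) (d : itvl) : Prop :=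
  [/\ nondominated (part s) d,
      exists Ht : R, [/\ 0 < Ht, nondominated_wrt (part s) Ht d
                   & lower_bound Ht d <= fmin s - xi]
    & eta < len d].

Definition selected (eta xi : R) (s : state) : {fset itvl} :=
  [fset d in part s | `[< selectable eta xi s d >]]%fset.

End Selection.

Definition trisect (s : state) (d : itvl) : state :=
  let p := d.1 + (d.2 - d.1) / 3 in
  let q := d.2 - (d.2 - d.1) / 3 in
  State ((part s `\ d) `|` [fset (d.1, p); (p, q); (q, d.2)])%fset
        (trials s ++ [:: (d.1 + p) / 2; (q + d.2) / 2]).

(* [o] lists the selected intervals in order of decreasing length; intervals
   of equal length may come in any order, so that one iteration is a relation
   between states rather than a function. *)
Definition mgas_step (N : nat) (f : R -> R) (eta xi : R) (s s' : state) : Prop :=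
  exists o : seq itvl,
    [/\ uniq o, o =i selected N f eta xi s,
        sorted (fun d e => len e <= len d) o
      & s' = foldl trisect s o].

Definition mgas_init : state :=
  State [fset (0, 1 / 3); (1 / 3, 2 / 3); (2 / 3, 1)]%fset
        [:: 1 / 6; 1 / 2; 5 / 6].

(* [run k] is the state at the beginning of iteration k >= 1 ([run 0]
   is unused).  The dependence of xi on the iteration, e.g. through the record
   value as in eps * `|fmin f (run k)|, is covered by an arbitrary sequence. *)
Definition mgas_run (N : nat) (f : R -> R) (eta : R) (xi : nat -> R)
    (run : nat -> state) : Prop :=
  run 1%N = mgas_init /\
  forall k, (1 <= k)%N -> mgas_step N f eta (xi k) (run k) (run k.+1).

(* Iteration k ends where iteration k + 1 begins, so these are the initial
   trial points together with those generated in iterations 1, ..., k. *)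
Definition trials_upto (run : nat -> state) (k : nat) : seq R :=
  trials (run k.+1).

Lemma mgas_run_exists N f eta xi : exists run, mgas_run N f eta xi run.
Proof.
pose le (d e : itvl) := len e <= len d.
pose nxt k s := foldl trisect s (sort le (selected N f eta (xi k) s)).
pose run := fix run k := if k is k'.+1 then
  (if k' is 0%N then mgas_init else nxt k' (run k')) else mgas_init.
exists run; split=> // -[//|k] _.
exists (sort le (selected N f eta (xi k.+1) (run k.+1))); split=> //.
- by rewrite sort_uniq fset_uniq.
- by move=> d; rewrite mem_sort.
- by apply: sort_sorted => d e; apply: le_total.
Qed.

End Mgas.

(* Main.v *)
Require Import Defs.
From mathcomp Require Import all_boot all_order all_algebra.
From mathcomp Require Import finmap lra.
From mathcomp Require Import boolp reals exp.
Import Order.TTheory GRing.Theory Num.Theory.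
Local Open Scope ring_scope.

(** For a sufficiently large trial constant the comparison of lower bounds is
    decided by the lengths first and by the values at the midpoints second, and
    the record condition holds whatever xi is. So every iteration trisects at
    least one longest interval of the partition. If all lengths are at most L,
    the finite set of intervals longer than L / 3 therefore strictly decreases
    until it is empty, and the mesh of the partition tends to 0. *)

Lemma seq_common_bound {R : realDomainType} {T : eqType} (P : T -> R -> Prop)
    (s : seq T) :
  (forall x, x \in s -> exists M, forall y, M <= y -> P x y) ->
  exists M, forall x, x \in s -> forall y, M <= y -> P x y.
Proof.
elim: s => [|a s IHs] Ps; first by exists 0.
have [M PM] : exists M, forall x, x \in s -> forall y, M <= y -> P x y.
  by apply: IHs => x xs; apply: Ps; rewrite inE xs orbT.
have [M' PM'] := Ps a (mem_head _ _).
exists (Num.max M M') => x + y; rewrite inE ge_max => xas /andP[My M'y].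
by case/orP: xas => [/eqP->|xs]; [exact: PM' | exact: PM].
Qed.

Section Mesh.
Set Implicit Arguments.
Unset Strict Implicit.
Context {R : realType}.
Implicit Types (s : state R) (d e : R * R) (L : R).

(** * Invariants of the partition under trisection *)

Definition mesh_le L s := forall d, d \in part s -> len d <= L.

(** Invariant of the run. Covering puts every point of the unit interval in some interval of the
    partition, and [mid_trial] then provides a trial point within half the length of that
    interval. *)
Record well_formed s : Prop := WellFormed {
  len_gt0 : forall d, d \in part s -> 0 < len d;
  mid_trial : forall d, d \in part s -> mid d \in trials s;
  part_cover : forall x, 0 <= x <= 1 ->
    exists2 d, d \in part s & d.1 <= x <= d.2
}.

Lemma mem_trisect s d e : e \in part (trisect s d) ->
  e != d /\ e \in part s \/ len e = len d / 3.
Proof.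
rewrite !inE => /orP[/andP[ed es]|]; first by left.
by case/orP => [/orP[]|] /eqP->; right; rewrite /len /=; lra.
Qed.

Lemma well_formed_init : well_formed (mgas_init R).
Proof.
split=> [d|d|x x01].
- by rewrite !inE => /orP[/orP[]|] /eqP->; rewrite /len /=; lra.
- rewrite !inE => /orP[/orP[]|] /eqP->; apply/or3P; rewrite /mid /=.
  + by apply: Or31; apply/eqP; lra.
  + by apply: Or32; apply/eqP; lra.
  + by apply: Or33; apply/eqP; lra.
- have [x1|x1] := leP x (1 / 3); last have [x2|x2] := leP x (2 / 3).
  + by exists (0, 1 / 3); rewrite ?inE ?eqxx ?orbT //=; lra.
  + by exists (1 / 3, 2 / 3); rewrite ?inE ?eqxx ?orbT //=; lra.
  + by exists (2 / 3, 1); rewrite ?inE ?eqxx ?orbT //=; lra.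
Qed.

Lemma well_formed_trisect s d :
  d \in part s -> well_formed s -> well_formed (trisect s d).
Proof.
move=> ds [l0 mt cov]; split=> [e|e|x x01].
- by case/mem_trisect => [[_ /l0]|->] //; have := l0 d ds; lra.
- rewrite /= mem_cat !inE => /orP[/andP[_ /mt->]//|].
  case/orP => [/orP[]|] /eqP->.
  + by rewrite {2}/mid eqxx orbT.
  (* The central third keeps the midpoint of [d], where a trial was already made; the two outer
     thirds receive the new trials. *)
  + suff -> : mid (d.1 + (d.2 - d.1) / 3, d.2 - (d.2 - d.1) / 3) = mid d.
      by rewrite mt.
    by rewrite /mid /=; lra.
  + by rewrite {3}/mid eqxx !orbT.
- have [e es ex] := cov x x01.
  have [ed|ed] := eqVneq e d; last by exists e; rewrite // !inE ed es.
  rewrite {e}ed in es ex.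
  have [x1|x1] := leP x (d.1 + (d.2 - d.1) / 3).
    by exists (d.1, d.1 + (d.2 - d.1) / 3); rewrite ?inE ?eqxx ?orbT //=; lra.
  have [x2|x2] := leP x (d.2 - (d.2 - d.1) / 3).
    exists (d.1 + (d.2 - d.1) / 3, d.2 - (d.2 - d.1) / 3);
    by rewrite ?inE ?eqxx ?orbT //=; lra.
  by exists (d.2 - (d.2 - d.1) / 3, d.2); rewrite ?inE ?eqxx ?orbT //=; lra.
Qed.

Lemma well_formed_foldl_trisect s (o : seq (R * R)) :
  uniq o -> {subset o <= part s} -> well_formed s ->
  well_formed (foldl (@trisect R) s o).
Proof.
elim: o s => //= d o IHo s /andP[dNo uo] os wf.
have ds : d \in part s by apply: os; rewrite mem_head.
apply: IHo => //; last exact: well_formed_trisect.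
(* Since the list has no repetition, the intervals still to be processed differ from [d] and survive
   its trisection. *)
move=> e eo; rewrite !inE (os e) ?inE ?eo ?orbT // andbT.
by case: eqVneq => // ed; rewrite -ed eo in dNo.
Qed.

Lemma mem_foldl_trisect s (o : seq (R * R)) e :
  e \in part (foldl (@trisect R) s o) ->
  e \notin o /\ e \in part s \/ exists2 d, d \in o & len e = len d / 3.
Proof.
elim: o s => [|d o IHo] s /=; first by left.
case/IHo => [[eNo]|[d' d'o ed']]; last first.
  by right; exists d'; rewrite // inE d'o orbT.
case/mem_trisect => [[ed es]|ed]; last by right; exists d; rewrite ?mem_head.
by left; rewrite inE negb_or ed.
Qed.

(** * Selection of a longest interval *)

Variables (N : nat) (f : R -> R).
Hypothesis N_gt0 : (1 <= N)%N.

Lemma longest_selected (xi : R) s d0 : well_formed s -> d0 \in part s ->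
  exists2 d, d \in selected N f 0 xi s &
    forall e, e \in part s -> len e <= len d.
Proof.
move=> wf d0s.
(* A lexicographic minimum of this key is, among the longest intervals, one with the least value at
   its midpoint. *)
pose key d : (R *l R)%type := (- len d, f (mid d)).
case: (@Order.TotalTheory.arg_minP _ _ (part s) [` d0s]%fset predT
         (fun j => key (val j))) => // i _ imin.
have dmin e : e \in part s ->
    len e < len (val i) \/ len e = len (val i) /\ f (mid (val i)) <= f (mid e).
  move=> es; have := imin [` es]%fset isT.
  rewrite Order.ProdLexiOrder.leEprodlexi /= !lerN2 => /andP[].
  rewrite le_eqVlt => /orP[/eqP->|]; last by left.
  by rewrite lexx => /= fe; right.
move: (val i) (valP i) dmin => {d0 d0s i imin} d ds dmin.
have dmax e : e \in part s -> len e <= len d.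
  by move=> /dmin [/ltW|[->]].
exists d => //.
pose g e : R := `|(e.2 - e.1) / 2| `^ N%:R^-1.
have Ninv : 0 < N%:R^-1 :> R by rewrite invr_gt0 ltr0n.
have gd0 : 0 < g d.
  by rewrite powR_gt0 // normr_gt0 gt_eqF // divr_gt0 //; apply: len_gt0 ds.
have glt e : e \in part s -> len e < len d -> g e < g d.
  move=> es ed; have := len_gt0 wf es; have := len_gt0 wf ds.
  rewrite /len in ed * => d0 e0.
  rewrite /g !ger0_norm ?divr_ge0 ?ltW//.
  by apply: gt0_ltr_powR; rewrite // ?nnegrE; lra.
have [M HM] : exists M, forall e, e \in enum_fset (part s) ->
    forall Ht, M <= Ht -> lower_bound N f Ht d <= lower_bound N f Ht e.
  apply: seq_common_bound => e es.
  have [ed|[ed fde]] := dmin e es; last first.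
    exists 0 => Ht _; rewrite /lower_bound.
    by move: ed; rewrite /len => ->; rewrite lerD2r.
  have dg : 0 < g d - g e by rewrite subr_gt0 glt.
  (* This is the value of [Ht] at which the two lower bounds coincide; beyond it the larger slope
     [g d] wins. *)
  exists ((f (mid d) - f (mid e)) / (g d - g e)) => Ht.
  rewrite ler_pdivrMr // /lower_bound -/(g d) -/(g e).
  lra.
(* From [M'] on, the lower bound of [d] is at most [fmin f s - xi]. In [Ht], the term 1 ensures
   positivity. *)
pose M' := (f (mid d) - (fmin f s - xi)) / g d.
pose Ht := Num.max 1 (Num.max M M').
have Ht0 : 0 < Ht by rewrite lt_max ltr01.
have ndom : nondominated_wrt N f (part s) Ht d.
  split=> // e es _; rewrite -leNgt; apply: HM => //.
  by rewrite !le_max lexx orbT.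
rewrite !inE ds; apply/asboolP; split; last exact: len_gt0 ds.
  by exists Ht.
exists Ht; split=> //.
have : M' <= Ht by rewrite !le_max lexx !orbT.
rewrite ler_pdivrMr // /lower_bound -/(g d).
lra.
Qed.

(** * Effect of one iteration on the mesh *)

Lemma mgas_step_well_formed (xi : R) s s' :
  mgas_step N f 0 xi s s' -> well_formed s -> well_formed s'.
Proof.
case=> o [uo oE _ ->]; apply: well_formed_foldl_trisect => // d.
by rewrite oE !inE => /andP[].
Qed.

Lemma mgas_step_mem (xi : R) L s s' e : mgas_step N f 0 xi s s' ->
  mesh_le L s -> e \in part s' ->
  e \notin selected N f 0 xi s /\ e \in part s \/ len e <= L / 3.
Proof.
case=> o [_ oE _ ->] sL /mem_foldl_trisect[|[d]]; rewrite oE; first by left.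
rewrite !inE => /andP[/sL dL _] ->; right; lra.
Qed.

Lemma mgas_step_mesh_le (xi : R) L s s' : 0 <= L ->
  mgas_step N f 0 xi s s' -> mesh_le L s -> mesh_le L s'.
Proof.
move=> L0 st sL e /(mgas_step_mem st sL) [[_ /sL]//|]; lra.
Qed.

(** The cardinality of this set is the measure that decreases until the mesh is at most [L / 3]. *)
Definition long_part L s : {fset R * R} := [fset d in part s | L / 3 < len d]%fset.

(** New intervals have length at most [L / 3], so none enters the set. A longest interval exceeds
    [L / 3], is selected, and leaves it. *)
Lemma mgas_step_long_part (xi : R) L s s' : well_formed s ->
  mgas_step N f 0 xi s s' -> mesh_le L s -> ~ mesh_le (L / 3) s ->
  (long_part L s' `<` long_part L s)%fset.
Proof.
move=> wf st sL nsL.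
have [d0 d0s d0L] : exists2 d, d \in part s & L / 3 < len d.
  apply: contrapT => nd; apply: nsL => d ds.
  by rewrite leNgt; apply/negP => dL; apply: nd; exists d.
have [d dsel dmax] := longest_selected xi wf d0s.
have ds : d \in part s by move: dsel; rewrite !inE => /andP[].
apply/andP; split; first apply/fsubsetP=> e.
  rewrite !inE => /andP[/(mgas_step_mem st sL) [[_ ->]//|]].
  by rewrite leNgt => /negPf->.
have dL : L / 3 < len d by apply: lt_le_trans d0L (dmax _ d0s).
apply/fsubsetPn; exists d; first by rewrite !inE ds.
rewrite !inE dL andbT; apply/negP => /(mgas_step_mem st sL).
by rewrite dsel leNgt dL => -[[]|].
Qed.

(** * Convergence of the mesh along a run *)

Variables (xi : nat -> R) (run : nat -> state R).
Hypothesis hrun : mgas_run N f 0 xi run.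

Lemma mgas_run_well_formed k : well_formed (run k.+1).
Proof.
have [run1 runS] := hrun; elim: k => [|k IHk].
  by rewrite run1; apply: well_formed_init.
exact: mgas_step_well_formed (runS k.+1 isT) IHk.
Qed.

Lemma mgas_run_mesh_le L k m : 0 <= L -> (k <= m)%N ->
  mesh_le L (run k.+1) -> mesh_le L (run m.+1).
Proof.
have [_ runS] := hrun; move=> L0 /subnK <-.
elim: (m - k)%N => //= n IHn kL; rewrite addSn.
exact (mgas_step_mesh_le L0 (runS (n + k).+1%N isT) (IHn kL)).
Qed.

Lemma mgas_run_mesh_third L k : 0 <= L -> mesh_le L (run k.+1) ->
  exists m, mesh_le (L / 3) (run m.+1).
Proof.
(* Induction on a strict bound for the number of intervals longer than [L / 3]. *)
move=> L0; have [n] := ubnP #|` long_part L (run k.+1)|.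
elim: n k => // n IHn k; rewrite ltnS => kn kL.
have [kL3|nkL3] := pselect (mesh_le (L / 3) (run k.+1)); first by exists k.
have [_ /(_ k.+1 isT) st] := hrun.
apply: (IHn k.+1); last exact: mgas_step_mesh_le L0 st kL.
apply: leq_trans kn; apply: fproper_ltn_card.
exact: mgas_step_long_part (mgas_run_well_formed k) st kL nkL3.
Qed.

Lemma mgas_run_mesh_pow n : exists k, mesh_le (3^-1 ^+ n) (run k.+1).
Proof.
elim: n => [|n [k kn]].
  exists 0; have [-> _] := hrun => d.
  by rewrite !inE => /orP[/orP[]|] /eqP->; rewrite /len /= expr0; lra.
by rewrite exprSr; apply: mgas_run_mesh_third kn; rewrite exprn_ge0 ?invr_ge0.
Qed.

Lemma mgas_run_mesh_cvg0 L : 0 < L ->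
  exists k, forall m, (k <= m)%N -> mesh_le L (run m.+1).
Proof.
move=> L0.
have [n nL] : exists n : nat, 3^-1 ^+ n <= L.
  (* With [n] an Archimedean bound of the inverse of [L], that inverse is below [n], hence below
     [3 ^ n]. *)
  exists (Num.bound L^-1); rewrite exprVn -[leRHS]invrK.
  rewrite lef_pV2 ?posrE ?invr_gt0 ?exprn_gt0 // -natrX.
  have /archi_boundP/ltW/le_trans -> // : 0 <= L^-1 by rewrite invr_ge0 ltW.
  by rewrite ler_nat ltnW // ltn_expl.
have [k kn] := mgas_run_mesh_pow n.
exists k => m km d dm; apply: le_trans nL.
by apply: mgas_run_mesh_le km kn _ dm; rewrite exprn_ge0 ?invr_ge0.
Qed.

End Mesh.

Theorem theorem3p3 (R : realType) (N : nat) (hN : (1 <= N)%N)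
  (f : R -> R) (H : R) (hH : 0 < H)
  (hf : forall x' x'' : R, x' \in `[0, 1] -> x'' \in `[0, 1] ->
          `|f x' - f x''| <= H * `|x' - x''| `^ (N%:R^-1))
  (eta : R) (heta : eta = 0)
  (xi : nat -> R) (hxi : forall k : nat, (1 <= k)%N -> 0 <= xi k)
  (run : nat -> state R) (hrun : mgas_run N f eta xi run)
  (x : R) (hx : x \in `[0, 1]) (delta : R) (hdelta : 0 < delta) :
  exists kd : nat, (1 <= kd)%N /\
    forall k : nat, (kd < k)%N ->
      exists x' : R, x' \in trials_upto run k /\ `|x - x'| < delta.
Proof.
subst eta.
have [k0 k0P] := mgas_run_mesh_cvg0 hN hrun hdelta.
(* The successor makes the iteration number at least 1. *)
exists k0.+1; split=> // k kk0.
have [l0 mt cov] := mgas_run_well_formed hrun k.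
have [d dk dx] : exists2 d, d \in part (run k.+1) & d.1 <= x <= d.2.
  by apply: cov; rewrite in_itv /= in hx.
(* As [x] lies in [d], its distance to [mid d] is at most half of [len d], and [len d] is positive
   and at most [delta]. *)
exists (mid d); split; first exact: mt.
have := k0P k (ltnW (ltnW kk0)) d dk.
have := l0 d dk; rewrite /len /mid ltr_norml; lra.
Qed.
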